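(* For $i=1,\ldots,m$, let $g_i:\mathbb{R}^n\times\mathbb{R}^{q_i}\to\mathbb{R}$ be a function such that for each $v_i\in\mathbb{R}^{q_i}$, $g_i(\cdot,v_i)$ is a SOS-convex polynomial with degree at most $d_i$. Let $\mathcal{V}_i\subset\mathbb{R}^{q_i}$, $i=1,\ldots,m$, be compact and let $$F:=\{x\in\mathbb{R}^n : g_i(x,v_i)\le 0\ \ \forall v_i\in\mathcal{V}_i,\ i=1,\ldots,m\}\neq\emptyset.$$ Then the following statements are equivalent: (i) For each SOS-convex real polynomial $f$ on $\mathbb{R}^n$ with $\operatorname{argmin}_{x\in F} f(x)\neq\emptyset$ and each $x^*\in F$, $$f(x^* )=\min_{x\in F} f(x)\iff\Big[\exists\,\bar v_i\in\mathcal{V}_i,\ \lambda_i\ge 0\ (i=1,\ldots,m):\ f(\cdot)-f(x^* )+\sum_{i=1}^m\lambda_i g_i(\cdot,\bar v_i)\in\Sigma^2_{k_0}\Big],$$ where $k_0$ is the smallest even number such that $k_0\ge\max\{\deg f,\max_{1\le i\le m} d_i\}$. (ii) For all $x\in F$, $$N_F(x)=\Big\{\sum_{i=1}^m\lambda_i\nabla_x g_i(x,v_i) : \lambda_i\ge 0,\ v_i\in\mathcal{V}_i,\ \lambda_i g_i(x,v_i)=0,\ i=1,\ldots,m\Big\}.$$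
   Context: A matrix polynomial $M\in\mathbb{R}[x]^{n\times n}$ is a SOS matrix polynomial if $M(x)=H(x)H(x)^T$ for some matrix polynomial $H\in\mathbb{R}[x]^{n\times r}$, $r\in\mathbb{N}$. A real polynomial $f$ on $\mathbb{R}^n$ is SOS-convex if its Hessian $x\mapsto\nabla^2 f(x)$ is a SOS matrix polynomial. $\Sigma^2_d$ denotes the set of all real polynomials of degree at most $d$ that are sums of squares of real polynomials. For a convex set $A$ and $x\in A$, $N_A(x):=\{v\in\mathbb{R}^n : v^T(y-x)\le 0\ \forall y\in A\}$ is the normal cone, and $\nabla_x$ denotes the gradient with respect to $x$. *)

(* Defs.v *)
From HB Require Import structures.
From mathcomp Require Import all_boot all_order all_algebra.
(* mpoly must be imported before mathcomp-analysis: in the other order their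
   notations clash. *)
From mathcomp Require Import mpoly.
From mathcomp Require Import all_classical all_reals all_analysis.

Set Implicit Arguments.
Unset Strict Implicit.
Unset Printing Implicit Defensive.

Import Order.TTheory GRing.Theory Num.Theory.
Import numFieldNormedType.Exports.

Local Open Scope classical_set_scope.
Local Open Scope ring_scope.

Section Polynomials.
Context {R : realType} {n : nat}.
Implicit Types (p : {mpoly R[n]}) (d N : nat).

Definition polyfun p : 'rV[R]_n -> R := fun x => p.@[x ord0].

(* [msize p] is 0 if p = 0 and one more than the degree otherwise, so the zero
   polynomial is given degree 0. *)
Definition mdegree p : nat := (msize p).-1.

Definition sos_mx (k : nat) (M : 'M[{mpoly R[n]}]_k) : Prop :=
  exists (r : nat) (H : 'M[{mpoly R[n]}]_(k, r)), M = H *m H^T.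

Definition hessian p : 'M[{mpoly R[n]}]_n :=
  \matrix_(i, j) mderiv i (mderiv j p).

Definition sos_convex p : Prop := sos_mx (hessian p).

Definition Sigma2 d : set {mpoly R[n]} :=
  [set p | (mdegree p <= d)%N /\
           exists (r : nat) (s : 'I_r -> {mpoly R[n]}), p = \sum_(i < r) s i ^+ 2].

End Polynomials.

Lemma exists_even_ge (N : nat) : exists k, ~~ odd k && (N <= k)%N.
Proof. by exists N.*2; rewrite odd_double -addnn leq_addr. Qed.

Definition least_even_ge (N : nat) : nat := ex_minn (exists_even_ge N).

Section Optimization.
Context {R : realType} {n : nat}.
Implicit Types (A F : set 'rV[R]_n) (f : 'rV[R]_n -> R).

Definition is_minimum (B : set R) (c : R) : Prop := B c /\ lbound B c.

Definition argmin F f : set 'rV[R]_n :=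
  [set x | F x /\ is_minimum (f @` F) (f x)].

Definition normal_cone A (x : 'rV[R]_n) : set 'rV[R]_n :=
  [set v | forall y, A y -> \sum_(j < n) v ord0 j * (y ord0 j - x ord0 j) <= 0].

Definition grad f (x : 'rV[R]_n) : 'rV[R]_n :=
  \row_(j < n) 'D_(delta_mx ord0 j) f x.

Definition feasible_set (m : nat) (q : 'I_m -> nat)
    (g : forall i, 'rV[R]_n -> 'rV[R]_(q i) -> R)
    (V : forall i, set 'rV[R]_(q i)) : set 'rV[R]_n :=
  [set x | forall i v, V i v -> g i x v <= 0].

End Optimization.

(* Main.v *)
Require Import Defs.
From HB Require Import structures.
From mathcomp Require Import all_boot all_order all_algebra.
From mathcomp Require Import mpoly.
From mathcomp Require Import all_classical all_reals all_analysis.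
From mathcomp Require Import ring.
Set Implicit Arguments.
Unset Strict Implicit.
Unset Printing Implicit Defensive.
Import Order.TTheory GRing.Theory Num.Theory.
Import numFieldNormedType.Exports.
Local Open Scope classical_set_scope.
Local Open Scope ring_scope.

(** Everything rests on one algebraic fact (Helton and Nie): if [p] is SOS-convex
    then, at every point [a], the remainder of its first-order Taylor expansion
    is a sum of squares of polynomials ([sos_convex_remainder]).  In particular
    [p] lies above its tangent planes, so the feasible set is convex.

    For the fact itself, restrict [p] to the line from [a] to the generic point
    [X]: this gives a polynomial [P] in one variable [t] whose coefficients are
    polynomials in [X].  A factorization [H H^T] of the Hessian exhibits [P''] as
    a sum of squares of polynomials in [t] ([deriv2_line_poly]), and the Taylor
    remainder is the iterated integral of [P''] over [0 <= s <= t <= 1]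
    ([taylor_iterated_integral]).  That integral sends [t^i] to
    1 / ((i + 1) (i + 2)), so on a square [Q^2] it is a quadratic form in the
    coefficients of [Q], with matrix 1 / ((i + j + 1) (i + j + 2)).  This matrix
    is the entrywise product of two Cauchy matrices, each of which is visibly a
    Gram matrix ([gram_kernel_cauchy]), hence it is a Gram matrix itself and the
    form is a sum of squares ([iterated_integral_sqr]).

    Given the fact, suppose that the normal cone formula holds and that [xs]
    minimizes [f] over [F].  Then [- grad f xs] is normal to [F], so some Lagrangian
    [f - f xs + \sum_i lambda_i g_i] vanishes at [xs] together with its gradient.
    It is SOS-convex, and it is equal to its own Taylor remainder at [xs]; thus it
    is a sum of squares.  Conversely, if the duality holds and [w] is normal to [F]
    at [x], then [x] minimizes the linear function [y |-> - w . y] on [F]; the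
    duality makes a Lagrangian of it a sum of squares that is nonpositive at [x].
    A sum of squares that is zero at a point has zero gradient there, and this
    is the required expression of [w].  The other halves of both statements
    need only the nonnegativity of sums of squares and the tangent plane
    inequality for the [g_i]. *)

(** * Restriction of a polynomial to a line *)

(** Identities that are compatible with sums and products need only be checked
    on constants and variables, so that no monomial has to be handled. *)
Lemma mpoly_ring_ind (R : comNzRingType) (n : nat) (P : {mpoly R[n]} -> Prop) :
  (forall c, P c%:MP) -> (forall i, P 'X_i) ->
  (forall p q, P p -> P q -> P (p + q)) ->
  (forall p q, P p -> P q -> P (p * q)) -> forall p, P p.
Proof.
move=> PC PX PD PM; elim/mpolyind => [|c m p _ _ Pp]; first by rewrite -mpolyC0.
apply: PD => //; rewrite -mul_mpolyC; apply: (PM) => //.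
rewrite mpolyXE_id; elim/big_ind: _ => //; first by rewrite -mpolyC1.
by move=> i _; elim: (m i) => [|k IH]; rewrite ?expr0 -?mpolyC1 // exprS; apply: PM.
Qed.

Lemma mderivXU (R : nzRingType) (n : nat) (i j : 'I_n) :
  mderiv j ('X_i : {mpoly R[n]}) = (i == j)%:R.
Proof.
rewrite mderivX mnm1E; case: eqP => [->|_]; last by rewrite scale0r.
have -> : (U_(j) - U_(j))%MM = 0%MM :> 'X_{1..n}.
  by apply/mnmP => k; rewrite mnmBE subnn mnm0E.
by rewrite scale1r mpolyX0.
Qed.

Section LinePoly.
Context {R A : comNzRingType} {n : nat} (iota : {rmorphism R -> A}).
Context (a u : 'I_n -> A).

(** The ring [A] is [R] for the restriction to an actual line, and
    [{mpoly R[n]}] for the line that joins a point to the generic point. *)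
Definition line_poly (p : {mpoly R[n]}) : {poly A} :=
  mmap (polyC \o iota) (fun i => (a i)%:P + u i *: 'X) p.

HB.instance Definition _ := GRing.RMorphism.copy line_poly line_poly.

Lemma line_polyC c : line_poly c%:MP = (iota c)%:P.
Proof. exact: mmapC. Qed.

Lemma line_polyX i : line_poly 'X_i = (a i)%:P + u i *: 'X.
Proof. by rewrite [LHS]mmapX mmap1U. Qed.

Lemma horner_line_poly t p :
  (line_poly p).[t] = mmap iota (fun i => a i + u i * t) p.
Proof.
elim/mpoly_ring_ind: p => [c|i|p q IHp IHq|p q IHp IHq].
- by rewrite line_polyC hornerC [RHS]mmapC.
- by rewrite line_polyX !hornerE [RHS]mmapX mmap1U.
- by rewrite rmorphD hornerD IHp IHq [RHS]rmorphD.
- by rewrite rmorphM hornerM IHp IHq [RHS]rmorphM.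
Qed.

Lemma deriv_line_poly p :
  (line_poly p)^`() = \sum_i u i *: line_poly p^`M(i).
Proof.
elim/mpoly_ring_ind: p => [c|i|p q IHp IHq|p q IHp IHq].
- rewrite line_polyC derivC big1 // => i _.
  by rewrite mderivC raddf0 scaler0.
- rewrite line_polyX derivD derivC add0r derivZ derivX (bigD1 i) //=.
  rewrite mderivXU eqxx rmorph1 big1 ?addr0 //.
  by move=> j /negbTE ji; rewrite mderivXU eq_sym ji rmorph0 scaler0.
- rewrite rmorphD derivD IHp IHq -big_split; apply: eq_bigr => i _.
  by rewrite mderivD rmorphD scalerDr.
- rewrite rmorphM derivM IHp IHq mulr_suml mulr_sumr -big_split.
  apply: eq_bigr => i _ /=.
  by rewrite mderivM rmorphD !rmorphM scalerDr scalerAl scalerAr.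
Qed.

(** Along a line of direction [u], the second derivative is the quadratic form
    [u^T (H H^T) u], the squared norm of [H^T u]. *)
Lemma deriv2_line_poly p r (H : 'M[{mpoly R[n]}]_(n, r)) :
  (forall i j, p^`M(i)^`M(j) = \sum_k H i k * H j k) ->
  (line_poly p)^`()^`() = \sum_k (\sum_i u i *: line_poly (H i k)) ^+ 2.
Proof.
move=> hessE; rewrite deriv_line_poly (linear_sum (@deriv _)) /=.
transitivity (\sum_i \sum_j \sum_k
    (u i *: line_poly (H i k)) * (u j *: line_poly (H j k))).
  apply: eq_bigr => i _; rewrite derivZ deriv_line_poly scaler_sumr.
  apply: eq_bigr => j _; rewrite hessE (rmorph_sum line_poly) !scaler_sumr.
  by apply: eq_bigr => k _; rewrite rmorphM /= -scalerAl -scalerAr.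
under [LHS]eq_bigr => i _ do rewrite exchange_big /=.
rewrite exchange_big; apply: eq_bigr => k _.
by rewrite expr2 mulr_suml; apply: eq_bigr => i _; rewrite mulr_sumr.
Qed.

End LinePoly.

(** * Gram matrices *)

Definition sum_of_squares (A : comNzRingType) (p : A) : Prop :=
  exists (r : nat) (s : 'I_r -> A), p = \sum_(i < r) s i ^+ 2.

Lemma sum_of_squares_sqr (A : comNzRingType) (p : A) : sum_of_squares (p ^+ 2).
Proof. by exists 1%N, (fun=> p); rewrite big_ord1. Qed.

Lemma sum_of_squares_sum (A : comNzRingType) (I : Type) (r : seq I) (p : I -> A) :
  (forall i, sum_of_squares (p i)) -> sum_of_squares (\sum_(i <- r) p i).
Proof.
move=> sp; elim/big_ind: _ => //; first by exists 0%N, (fun=> 0); rewrite big_ord0.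
move=> _ _ [r1 [s1 ->]] [r2 [s2 ->]].
exists (r1 + r2)%N,
  (fun i => match fintype.split i with inl j => s1 j | inr j => s2 j end).
rewrite big_split_ord; congr (_ + _); apply: eq_bigr => i _.
  by rewrite (unsplitK (inl i)).
by rewrite (unsplitK (inr i)).
Qed.

(** The leading [N] by [N] block of [W] is a Gram matrix.  Matrices are given by
    functions on [nat] so that [N] can vary in an induction, and the factor by the
    list of its columns. *)
Definition gram_kernel (R : pzRingType) (N : nat) (W : nat -> nat -> R) : Prop :=
  exists bs : seq (nat -> R), forall j l, (j < N)%N -> (l < N)%N ->
    W j l = \sum_(b <- bs) b j * b l.

(** Eliminating the last row and column of a Cauchy matrix (a Schur complement)
    leaves the same Cauchy matrix, conjugated by the diagonal matrix with entries
    [(x j - x N) / (x j + x N)]. *)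
Lemma gram_kernel_cauchy (R : rcfType) (x : nat -> R) (N : nat) :
  (forall j, 0 < x j) -> gram_kernel N (fun j l => (x j + x l)^-1).
Proof.
move=> x_gt0; elim: N => [|N [bs bsE]]; first by exists [::].
pose u j := (x j - x N) / (x j + x N).
pose v j := Num.sqrt (2 * x N) / (x j + x N).
have D0 j l : x j + x l != 0 by rewrite gt_eqF// addr_gt0.
have step j l : (x j + x l)^-1 = v j * v l + u j * u l * (x j + x l)^-1.
  rewrite [v j * v l]mulrACA -expr2 sqr_sqrtr; last by rewrite mulr_ge0// ltW.
  by rewrite /u; field; rewrite !D0.
exists (v :: [seq (fun j => u j * b j) | b <- bs]) => j l jN lN.
rewrite big_cons big_map step; congr (_ + _).
under eq_bigr do rewrite mulrACA.
rewrite -mulr_sumr.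
have uN : u N = 0 by rewrite /u subrr mul0r.
move: jN; rewrite ltnS leq_eqVlt => /predU1P[->|jN]; first by rewrite uN !mul0r.
move: lN; rewrite ltnS leq_eqVlt => /predU1P[->|lN].
  by rewrite uN mulr0 !mul0r.
by rewrite bsE.
Qed.

(** Schur's product theorem: the entrywise products of the factors factor the
    entrywise product. *)
Lemma gram_kernelM (R : comPzRingType) (N : nat) (W1 W2 : nat -> nat -> R) :
  gram_kernel N W1 -> gram_kernel N W2 ->
  gram_kernel N (fun j l => W1 j l * W2 j l).
Proof.
move=> [bs1 bs1E] [bs2 bs2E].
exists [seq (fun j => b1 j * b2 j) | b1 <- bs1, b2 <- bs2] => j l jN lN.
rewrite bs1E// bs2E// big_allpairs_dep mulr_suml; apply: eq_bigr => b1 _.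
by rewrite mulr_sumr; apply: eq_bigr => b2 _; rewrite mulrACA.
Qed.

(** * The iterated integral of a square *)

(** The integral of [s^i] over the triangle [0 <= s <= t <= 1]. *)
Definition iterated_moment (R : fieldType) (i : nat) : R := (i.+1 * i.+2)%:R^-1.

(** 1 / (j + l + 1) and 1 / (j + l + 2) are the Cauchy matrices of the points
    [j + 1/2] and [j + 1]. *)
Lemma gram_kernel_iterated_moment (R : rcfType) (N : nat) :
  gram_kernel N (fun j l => iterated_moment R (j + l)).
Proof.
have x1_gt0 j : 0 < j%:R + 2^-1 :> R by rewrite ltr_wpDl ?invr_gt0.
have x2_gt0 j : 0 < j.+1%:R :> R by rewrite ltr0Sn.
have [bs bsE] := gram_kernelM (gram_kernel_cauchy N x1_gt0)
                              (gram_kernel_cauchy N x2_gt0).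
exists bs => j l jN lN; rewrite -bsE// /iterated_moment natrM invfM.
by congr (_^-1 * _^-1); rewrite -!natr1 natrD; field.
Qed.

Section IteratedIntegral.
Context {R : rcfType} {A : comAlgType R}.
Implicit Types (P Q : {poly A}).

Definition iterated_integral P : A :=
  \sum_(i < size P) iterated_moment R i *: P`_i.

(** Polynomials of different sizes are compared through a common bound on their
    sizes. *)
Lemma iterated_integralE N P : (size P <= N)%N ->
  iterated_integral P = \sum_(i < N) iterated_moment R i *: P`_i.
Proof.
move=> PN; rewrite /iterated_integral.
rewrite -!(big_mkord xpredT (fun i => iterated_moment R i *: P`_i)).
rewrite (big_cat_nat (leq0n _) PN)//= [X in _ + X]big1_seq ?addr0// => i.
by rewrite mem_index_iota => /and3P[_ Pi _]; rewrite nth_default ?scaler0.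
Qed.

Lemma iterated_integralB : {morph iterated_integral : P Q / P - Q}.
Proof.
move=> P Q; pose N := maxn (size P) (size Q).
have PN : (size P <= N)%N := leq_maxl _ _.
have QN : (size Q <= N)%N := leq_maxr _ _.
have PQN : (size (P - Q)%R <= N)%N.
  by apply: leq_trans (size_polyD _ _) _; rewrite size_polyN.
rewrite !(iterated_integralE PN, iterated_integralE QN, iterated_integralE PQN).
by rewrite -sumrB; apply: eq_bigr => i _; rewrite coefB scalerBr.
Qed.

HB.instance Definition _ :=
  GRing.isZmodMorphism.Build {poly A} A iterated_integral
    iterated_integralB.

Lemma iterated_integral_monomial (c : A) i :
  iterated_integral (c *: 'X^i) = iterated_moment R i *: c.
Proof.
have sz : (size (c *: 'X^i) <= i.+1)%N.
  by rewrite (leq_trans (size_scale_leq _ _))// size_polyXn.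
rewrite (iterated_integralE sz) big_ord_recr /= big1 ?add0r.
  by rewrite coefZ coefXn eqxx mulr1.
by move=> j _; rewrite coefZ coefXn ltn_eqF// mulr0 scaler0.
Qed.

(** Taylor's formula at [0], evaluated at [1]; the integral over the triangle is
    the integral of [(1 - s) P''(s)] over the unit interval. *)
Lemma taylor_iterated_integral P :
  P.[1] - P.[0] - P^`().[0] = iterated_integral P^`()^`().
Proof.
rewrite -[P]coefK poly_def !(linear_sum (@deriv A)) !horner_sum -!sumrB raddf_sum /=.
apply: eq_bigr => -[j _] _ /=; move: (P`_j) => c {P}; rewrite !derivZ.
case: j => [|[|i]].
- by rewrite expr0 (derivC 1) !raddf0 !hornerE !subrr.
- by rewrite expr1 derivX (derivC 1) !raddf0 !hornerE subr0 subrr.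
rewrite derivXn derivMn derivXn -mulrnA -!scalerMnr (raddfMn iterated_integral) /=.
rewrite iterated_integral_monomial -[RHS]scaler_nat scalerA divff ?pnatr_eq0//.
rewrite scale1r hornerMn.
by rewrite !hornerZ !hornerXn expr1n !expr0n /= !mulr0 mul0rn mulr1 !subr0.
Qed.

Lemma iterated_integral_sqr Q : sum_of_squares (iterated_integral (Q ^+ 2)).
Proof.
have [bs bsE] := gram_kernel_iterated_moment R (size Q).
suff -> : iterated_integral (Q ^+ 2) =
    \sum_(b <- bs) (\sum_(j < size Q) b j *: Q`_j) ^+ 2.
  by apply: sum_of_squares_sum => b; apply: sum_of_squares_sqr.
rewrite -[Q in LHS]coefK poly_def expr2 mulr_suml raddf_sum /=.
under [RHS]eq_bigr do rewrite expr2 mulr_suml.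
rewrite exchange_big; apply: eq_bigr => j _.
under [RHS]eq_bigr do rewrite mulr_sumr.
rewrite mulr_sumr raddf_sum exchange_big; apply: eq_bigr => l _ /=.
rewrite -scalerAl -scalerAr scalerA -exprD iterated_integral_monomial bsE//.
rewrite scaler_suml; apply: eq_bigr => b _.
by rewrite -scalerAl -scalerAr scalerA.
Qed.

End IteratedIntegral.

(** * The Taylor remainder of an SOS-convex polynomial *)

Section SosConvex.
Context {R : realType} {n : nat}.
Implicit Types (p : {mpoly R[n]}) (a x y : 'I_n -> R).

(** The remainder is the iterated integral of the second derivative of [p] along
    the line from [a] to the generic point, which is a sum of squares in the
    parameter of that line. *)
Lemma sos_convex_remainder p a : sos_convex p ->
  sum_of_squares
    (p - p.@[a]%:MP - \sum_(i < n) p^`M(i).@[a] *: ('X_i - (a i)%:MP)).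
Proof.
move=> [r [H hessE]].
pose u i : {mpoly R[n]} := 'X_i - (a i)%:MP.
pose L := line_poly (@mpolyC n R) (fun i => (a i)%:MP) u.
(* The line starts at [a] and reaches the generic point at time [1]. *)
have L0 q : (L q).[0] = q.@[a]%:MP.
  rewrite horner_line_poly; elim/mpoly_ring_ind: q => [c|i|q s IHq IHs|q s IHq IHs].
  - by rewrite [LHS]mmapC mevalC.
  - by rewrite [LHS]mmapX mmap1U mevalXU mulr0 addr0.
  - by rewrite [LHS]rmorphD /= IHq IHs mevalD mpolyCD.
  - by rewrite [LHS]rmorphM /= IHq IHs mevalM mpolyCM.
have L1 q : (L q).[1] = q.
  rewrite horner_line_poly; elim/mpoly_ring_ind: q => [c|i|q s IHq IHs|q s IHq IHs].
  - by rewrite [LHS]mmapC.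
  - by rewrite [LHS]mmapX mmap1U mulr1 addrC subrK.
  - by rewrite [LHS]rmorphD /= IHq IHs.
  - by rewrite [LHS]rmorphM /= IHq IHs.
(* [p^`M(i)^`M(j)] is the entry [(j, i)] of the Hessian. *)
have hessE' i j : p^`M(i)^`M(j) = \sum_k H i k * H j k.
  have := congr1 (fun M : 'M[{mpoly R[n]}]_n => M j i) hessE.
  by rewrite !mxE => ->; apply: eq_bigr => k _; rewrite mxE mulrC.
have -> : p - p.@[a]%:MP - \sum_(i < n) p^`M(i).@[a] *: u i =
    iterated_integral (L p)^`()^`().
  rewrite -taylor_iterated_integral L1 L0; congr (_ - _).
  rewrite deriv_line_poly horner_sum; apply: eq_bigr => i _.
  by rewrite hornerZ L0 mulrC mul_mpolyC.
rewrite (deriv2_line_poly _ _ _ hessE') raddf_sum; apply: sum_of_squares_sum => k.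
exact: iterated_integral_sqr.
Qed.

End SosConvex.

(** * Gradients and convexity of polynomial functions *)

Section PolyFun.
Context {R : realType} {n : nat}.
Implicit Types (p q : {mpoly R[n]}) (x y v : 'rV[R]_n).

Lemma horner_line_polyfun p x v t :
  (line_poly idfun (x ord0) (v ord0) p).[t] = polyfun p (t *: v + x).
Proof.
rewrite [LHS]horner_line_poly; apply: meval_eq => i.
by rewrite !mxE addrC mulrC.
Qed.

Lemma deriv_line_polyfun p x v :
  (line_poly idfun (x ord0) (v ord0) p)^`().[0] =
  \sum_i v ord0 i * p^`M(i).@[x ord0].
Proof.
rewrite deriv_line_poly horner_sum; apply: eq_bigr => i _.
by rewrite hornerZ horner_line_polyfun scale0r add0r.
Qed.

Lemma derive_polyfun p x v :
  'D_v (polyfun p) x = \sum_i v ord0 i * p^`M(i).@[x ord0].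
Proof.
pose L := line_poly idfun (x ord0) (v ord0) p.
transitivity ('D_1 (horner L) 0).
  rewrite /derive; apply: (congr1 (fun F : R -> R^o => lim (F @ 0^'))).
  apply/funext => h /=; rewrite !horner_line_polyfun scale0r add0r addr0.
  by rewrite /GRing.scale/= mulr1.
by rewrite -derive1E -derivE deriv_line_polyfun.
Qed.

Lemma grad_polyfun p x : grad (polyfun p) x = \row_j p^`M(j).@[x ord0].
Proof.
apply/rowP => j; rewrite !mxE derive_polyfun (bigD1 j)//= !mxE !eqxx mul1r.
by rewrite big1 ?addr0// => i /negbTE ij; rewrite mxE ij andbF mul0r.
Qed.

Lemma sum_of_squares_ge0 p x : sum_of_squares p -> 0 <= polyfun p x.
Proof.
move=> [r [s ->]]; rewrite /polyfun raddf_sum; apply: sumr_ge0 => i _.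
by rewrite /= rmorphXn sqr_ge0.
Qed.

(** Where a sum of squares vanishes, so does every square, and the derivative of
    [s ^+ 2] has [s] as a factor. *)
Lemma sum_of_squares_grad0 p x :
  sum_of_squares p -> polyfun p x = 0 -> grad (polyfun p) x = 0.
Proof.
move=> [r [s ->]]; rewrite {1}/polyfun raddf_sum => /eqP.
rewrite psumr_eq0 => [|i _]; last by rewrite /= rmorphXn sqr_ge0.
move=> /allP s0; rewrite grad_polyfun; apply/rowP => j.
rewrite !mxE (raddf_sum (mderiv j)) (raddf_sum (meval (x ord0))) big1// => i _ /=.
have := s0 i (mem_index_enum _); rewrite /= rmorphXn /= sqrf_eq0 => /eqP si0.
by rewrite expr2 mderivM rmorphD !rmorphM /= si0 mulr0 mul0r addr0.
Qed.

Lemma sos_convex_gradient_le p x y : sos_convex p ->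
  polyfun p x + \sum_i grad (polyfun p) x ord0 i * (y ord0 i - x ord0 i)
  <= polyfun p y.
Proof.
move=> cp; have := sum_of_squares_ge0 y (sos_convex_remainder (x ord0) cp).
rewrite /polyfun !mevalB mevalC (raddf_sum (meval (y ord0))) -addrA -opprD subr_ge0.
rewrite grad_polyfun; congr (_ + _ <= _); apply: eq_bigr => i _.
by rewrite /= mxE mevalZ mevalB mevalXU mevalC.
Qed.

(** Average of the tangent plane inequalities at [z = x + t (y - x)] towards [x]
    and towards [y], with weights [1 - t] and [t]: the linear terms cancel. *)
Lemma sos_convex_jensen p x y t : sos_convex p -> 0 <= t <= 1 ->
  polyfun p (t *: (y - x) + x) <= (1 - t) * polyfun p x + t * polyfun p y.
Proof.
move=> cp /andP[t0 t1]; set z := t *: _ + _.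
have /(ler_wpM2l t0) := sos_convex_gradient_le z y cp.
have t1' : 0 <= 1 - t by rewrite subr_ge0.
have /(ler_wpM2l t1') := sos_convex_gradient_le z x cp.
rewrite !mulrDr => hx hy; have := lerD hx hy.
rewrite addrACA -mulrDl subrK mul1r !mulr_sumr -big_split /= big1 ?addr0//.
by move=> i _; rewrite /z !mxE; ring.
Qed.

End PolyFun.

(** With [P = Q X + P(0)], the derivative is [Q(0)]; if it were negative, [Q]
    would still be negative at some small positive [t], where [P(t) < P(0)]. *)
Lemma deriv_ge0_of_right_min (R : realType) (P : {poly R}) :
  (forall t, 0 <= t <= 1 -> P.[0] <= P.[t]) -> 0 <= P^`().[0].
Proof.
move=> Pmin.
have /factor_theorem[Q PQ] : root (P - P.[0]%:P) 0 by rewrite /root !hornerE subrr.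
have PE : P = Q * 'X + P.[0]%:P by rewrite -['X]subr0 -polyC0 -PQ subrK.
have -> : P^`().[0] = Q.[0].
  by rewrite PE derivD derivC derivM derivX !hornerE.
rewrite leNgt; apply/negP => Q0.
have Qc : {for 0, continuous (horner Q)} by exact: continuous_horner.
have : \forall t \near 0^'+, Q.[t] < 0.
  by apply: cvgr_lt Q0; apply: cvg_at_right_filter; exact: Qc.
move=> Qneg; near (0 : R)^'+ => t.
have t0 : 0 < t by near: t; exact: nbhs_right_gt.
have t1 : t <= 1 by near: t; apply: nbhs_right_le.
have : Q.[t] < 0 by near: t.
apply/negP; rewrite -leNgt.
have := Pmin t; rewrite (ltW t0) t1 => /(_ isT).
by rewrite [X in _ <= X.[t]]PE !hornerE lerDr pmulr_lge0.
Unshelve. all: by end_near. Qed.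

(** First-order optimality condition.  Only segments that issue from [x] are
    followed, so it suffices that [F] be star-shaped at [x]. *)
Lemma min_neg_grad_normal_cone (R : realType) (n : nat) (F : set 'rV[R]_n)
    (p : {mpoly R[n]}) (x : 'rV[R]_n) :
  (forall y t, F y -> 0 <= t <= 1 -> F (t *: (y - x) + x)) ->
  (forall y, F y -> polyfun p x <= polyfun p y) ->
  normal_cone F x (- grad (polyfun p) x).
Proof.
move=> Fstar xmin y Fy.
have : 0 <= (line_poly idfun (x ord0) ((y - x) ord0) p)^`().[0].
  apply: deriv_ge0_of_right_min => t t01.
  rewrite !horner_line_polyfun scale0r add0r.
  by apply: xmin; exact: Fstar.
rewrite deriv_line_polyfun -oppr_le0 -sumrN; congr (_ <= _).
by apply: eq_bigr => i _; rewrite grad_polyfun !mxE mulNr mulrC.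
Qed.

(** * The cone of SOS-convex polynomials and Lagrangians *)

Section SosConvexCone.
Context {R : realType} {n : nat}.
Implicit Types (p q : {mpoly R[n]}).

Lemma hessian0_sos_convex p :
  (forall i j, p^`M(i)^`M(j) = 0) -> sos_convex p.
Proof.
move=> p0; exists 0%N, 0; apply/matrixP => i j.
by rewrite mul0mx !mxE p0.
Qed.

Lemma sos_convexC c : sos_convex (c%:MP : {mpoly R[n]}).
Proof. by apply: hessian0_sos_convex => i j; rewrite !mderivC. Qed.

Lemma sos_convexD p q : sos_convex p -> sos_convex q -> sos_convex (p + q).
Proof.
move=> [r1 [H1 h1]] [r2 [H2 h2]]; exists (r1 + r2)%N, (row_mx H1 H2).
rewrite tr_row_mx mul_row_col -h1 -h2; apply/matrixP => i j.
by rewrite !mxE !mderivD.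
Qed.

Lemma sos_convexZ c p : 0 <= c -> sos_convex p -> sos_convex (c *: p).
Proof.
move=> c0 [r [H h]]; exists r, ((Num.sqrt c)%:MP *: H).
rewrite linearZ -scalemxAl -scalemxAr scalerA -mpolyCM -expr2 sqr_sqrtr// -h.
by apply/matrixP => i j; rewrite !mxE !mderivZ mul_mpolyC.
Qed.

Lemma sos_convex_sum (I : Type) (r : seq I) (p : I -> {mpoly R[n]}) :
  (forall i, sos_convex (p i)) -> sos_convex (\sum_(i <- r) p i).
Proof.
move=> cp; apply: big_ind => //; last by move=> ? ?; exact: sos_convexD.
by rewrite -mpolyC0; exact: sos_convexC.
Qed.

Lemma mderiv_linear_form (w : 'I_n -> R) j :
  (\sum_i w i *: 'X_i)^`M(j) = (w j)%:MP :> {mpoly R[n]}.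
Proof.
rewrite raddf_sum (bigD1 j)//= mderivZ mderivXU eqxx -mul_mpolyC mulr1.
by rewrite big1 ?addr0// => i /negbTE ij; rewrite mderivZ mderivXU ij scaler0.
Qed.

Lemma mdegree_leE p d : (mdegree p <= d)%N = (msize p <= d.+1)%N.
Proof. by rewrite /mdegree -subn1 leq_subLR add1n. Qed.

End SosConvexCone.

Lemma least_even_ge_le N : (N <= least_even_ge N)%N.
Proof. by rewrite /least_even_ge; case: ex_minnP => k /andP[]. Qed.

Lemma feasible_set_segment (R : realType) (n m : nat) (q : 'I_m -> nat)
    (g : forall i : 'I_m, 'rV[R]_n -> 'rV[R]_(q i) -> R)
    (V : forall i : 'I_m, set 'rV[R]_(q i)) (x y : 'rV[R]_n) (t : R) :
  (forall i v, exists2 p : {mpoly R[n]}, sos_convex p & g i ^~ v = polyfun p) ->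
  feasible_set g V x -> feasible_set g V y -> 0 <= t <= 1 ->
  feasible_set g V (t *: (y - x) + x).
Proof.
move=> g_sos_convex Fx Fy t01 i v Vv; have [p cp gp] := g_sos_convex i v.
have gE z : g i z v = polyfun p z by rewrite -gp.
rewrite gE (le_trans (sos_convex_jensen x y cp t01))// -!gE.
case/andP: t01 => t0 t1.
by rewrite -[leRHS]addr0 lerD// mulr_ge0_le0 ?subr_ge0//; [apply: Fx|apply: Fy].
Qed.

(** The Lagrangian is given as a function in the theorem; it is needed as a
    polynomial, for its Hessian and its degree. *)
Lemma lagrangian_poly (R : realType) (n m : nat) (q d : 'I_m -> nat)
    (g : forall i : 'I_m, 'rV[R]_n -> 'rV[R]_(q i) -> R)
    (v : forall i, 'rV[R]_(q i)) (lambda : 'I_m -> R)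
    (f : {mpoly R[n]}) (xs : 'rV[R]_n) :
  (forall i v, exists p : {mpoly R[n]},
     [/\ sos_convex p, (mdegree p <= d i)%N & g i ^~ v = polyfun p]) ->
  sos_convex f -> (forall i, 0 <= lambda i) ->
  exists h : {mpoly R[n]},
    [/\ sos_convex h,
        (mdegree h <= maxn (mdegree f) (\max_(i < m) d i))%N,
        polyfun h = (fun x => polyfun f x - polyfun f xs
                              + \sum_(i < m) lambda i * g i x (v i))
      & forall x, grad (polyfun h) x =
          grad (polyfun f) x + \sum_(i < m) lambda i *: grad (g i ^~ (v i)) x].
Proof.
move=> g_sos_convex cf lambda0.
have /choice[p pP] : forall i, exists p : {mpoly R[n]},
    [/\ sos_convex p, (mdegree p <= d i)%N & g i ^~ (v i) = polyfun p].
  by move=> i; exact: g_sos_convex.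
exists (f + (- polyfun f xs)%:MP + \sum_i lambda i *: p i); split.
- apply: sos_convexD; first exact: sos_convexD cf (sos_convexC _).
  by apply: sos_convex_sum => i; apply: sos_convexZ => //; case: (pP i).
- rewrite mdegree_leE; set N := maxn _ _.
  apply: leq_trans (msizeD_le _ _) _; rewrite geq_max; apply/andP; split.
    apply: leq_trans (msizeD_le _ _) _.
    by rewrite geq_max -mdegree_leE leq_maxl msizeC (leq_trans (leq_b1 _)).
  apply: leq_trans (msize_sum _ _ _) _; apply/bigmax_leqP => i _.
  apply: leq_trans (msizeZ_le _ _) _; rewrite -mdegree_leE.
  have [_ /leq_trans pd _] := pP i; apply: pd.
  exact: leq_trans (leq_bigmax i) (leq_maxr _ _).
- apply/funext => x; rewrite /polyfun !mevalD mevalC; congr (_ + _).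
  rewrite (raddf_sum (meval (x ord0))); apply: eq_bigr => i _ /=.
  by rewrite mevalZ; case: (pP i) => _ _ /(congr1 (fun k => k x)) /= ->.
- move=> x; apply/rowP => j; rewrite !grad_polyfun mxE mxE [in RHS]mxE summxE.
  rewrite !mderivD mderivC addr0 mevalD; congr (_ + _).
  rewrite (raddf_sum (mderiv j)) (raddf_sum (meval (x ord0))).
  apply: eq_bigr => i _; case: (pP i) => _ _ ->.
  by rewrite mxE grad_polyfun mxE /= mderivZ mevalZ.
Qed.

(** * Lagrangian duality and the normal cone formula *)

Theorem theorem2p2 (R : realType) (n m : nat) (q d : 'I_m -> nat)
    (g : forall i : 'I_m, 'rV[R]_n -> 'rV[R]_(q i) -> R)
    (V : forall i : 'I_m, set 'rV[R]_(q i))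
    (g_sos_convex : forall (i : 'I_m) (v : 'rV[R]_(q i)),
       exists p : {mpoly R[n]},
         [/\ sos_convex p, (mdegree p <= d i)%N & g i ^~ v = polyfun p])
    (V_compact : forall i : 'I_m, compact (V i))
    (F_neq0 : feasible_set g V !=set0) :
  let F := feasible_set g V in
  (forall f : {mpoly R[n]}, sos_convex f ->
     argmin F (polyfun f) !=set0 ->
     forall xs : 'rV[R]_n, F xs ->
       (is_minimum (polyfun f @` F) (polyfun f xs) <->
        exists (v : forall i : 'I_m, 'rV[R]_(q i)) (lambda : 'I_m -> R),
          (forall i, V i (v i) /\ 0 <= lambda i) /\
          exists2 p : {mpoly R[n]},
            Sigma2 (least_even_ge (maxn (mdegree f) (\max_(i < m) d i))) p &
            polyfun p = (fun x => polyfun f x - polyfun f xs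
                                  + \sum_(i < m) lambda i * g i x (v i))))
  <->
  (forall x : 'rV[R]_n, F x ->
     normal_cone F x =
     [set w | exists (v : forall i : 'I_m, 'rV[R]_(q i)) (lambda : 'I_m -> R),
        (forall i, [/\ 0 <= lambda i, V i (v i) & lambda i * g i x (v i) = 0]) /\
        w = \sum_(i < m) lambda i *: grad (g i ^~ (v i)) x]).
Proof.
move=> F; split=> [duality x Fx|cone f cf _ xs Fxs].
- apply/seteqP; split=> w /=.
  + move=> wN.
    (* Normality of [w] at [x] says that [x] minimizes [y |-> - w . y] on [F]. *)
    pose f : {mpoly R[n]} := \sum_i (- w ord0 i) *: 'X_i.
    have dfE j : f^`M(j) = (- w ord0 j)%:MP by exact: mderiv_linear_form.
    have cf : sos_convex f.
      by apply: hessian0_sos_convex => i j; rewrite dfE mderivC.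
    have fE y : polyfun f y = \sum_i (- w ord0 i) * y ord0 i.
      rewrite /polyfun (raddf_sum (meval (y ord0))); apply: eq_bigr => i _ /=.
      by rewrite mevalZ mevalXU.
    have xmin : is_minimum (polyfun f @` F) (polyfun f x).
      split=> [|_ [y Fy <-]]; first by exists x.
      rewrite !fE -subr_ge0 -sumrB -oppr_le0 -sumrN.
      have := wN y Fy; congr (_ <= _); apply: eq_bigr => i _.
      by rewrite -mulrBr mulNr opprK.
    have argf : argmin F (polyfun f) !=set0 by exists x.
    have [v [lambda [vl [p [_ sp] pE]]]] := (duality f cf argf x Fx).1 xmin.
    exists v, lambda.
    have [h [_ _ hE hgrad]] :=
      lagrangian_poly v x g_sos_convex cf (fun i => (vl i).2).
    have gle0 i : lambda i * g i x (v i) <= 0.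
      by have [Vv l0] := vl i; rewrite mulr_ge0_le0//; exact: Fx.
    have px : polyfun p x = \sum_(i < m) lambda i * g i x (v i).
      by rewrite pE subrr add0r.
    (* [p x] is nonnegative as a value of a sum of squares and nonpositive as a
       sum of nonpositive terms, so complementary slackness follows. *)
    have px0 : polyfun p x = 0.
      by apply/eqP; rewrite eq_le sum_of_squares_ge0// px sumr_le0.
    have g0 i : lambda i * g i x (v i) = 0.
      have /eqP := px; rewrite px0 eq_sym -oppr_eq0 -sumrN psumr_eq0; last first.
        by move=> k _; rewrite oppr_ge0.
      by move/allP/(_ i (mem_index_enum _)); rewrite /= oppr_eq0 => /eqP.
    split=> [i|]; first by have [Vv l0] := vl i.
    have := sum_of_squares_grad0 sp px0; rewrite pE -hE hgrad => /eqP.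
    rewrite addrC addr_eq0 => /eqP ->; apply/rowP => j.
    by rewrite mxE grad_polyfun mxE dfE mevalC opprK.
  + move=> [v [lambda [vl ->]]] y Fy.
    have -> : \sum_(j < n) (\sum_(i < m) lambda i *: grad (g i ^~ (v i)) x) ord0 j
          * (y ord0 j - x ord0 j)
        = \sum_(i < m) lambda i *
            \sum_(j < n) grad (g i ^~ (v i)) x ord0 j * (y ord0 j - x ord0 j).
      under eq_bigr => j _ do rewrite summxE mulr_suml.
      rewrite exchange_big; apply: eq_bigr => i _.
      by rewrite mulr_sumr; apply: eq_bigr => j _; rewrite mxE mulrA.
    apply: sumr_le0 => i _; have [l0 Vv lg0] := vl i.
    have [p [cp _ gp]] := g_sos_convex i (v i).
    have gE z : g i z (v i) = polyfun p z by rewrite -gp.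
    have := sos_convex_gradient_le x y cp.
    rewrite -gp => /(ler_wpM2l l0); rewrite mulrDr lg0 add0r => /le_trans; apply.
    by rewrite mulr_ge0_le0//; exact: Fy.
split=> [xmin|[v [lambda [vl [p [_ sp] pE]]]]].
- have : normal_cone F xs (- grad (polyfun f) xs).
    apply: min_neg_grad_normal_cone => [y t Fy t01|y Fy].
      apply: feasible_set_segment => // i v.
      by have [p [cp _ gp]] := g_sos_convex i v; exists p.
    by apply: xmin.2; exists y.
  rewrite cone//= => -[v [lambda [vl gradE]]].
  exists v, lambda; split=> [i|]; first by have [] := vl i.
  have l0 i : 0 <= lambda i by have [] := vl i.
  have [h [ch degh hE hgrad]] := lagrangian_poly v xs g_sos_convex cf l0.
  exists h => //; split; first exact: leq_trans degh (least_even_ge_le _).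
  have hxs : polyfun h xs = 0.
    by rewrite hE subrr add0r big1// => i _; have [] := vl i.
  (* [h] is its own remainder: its value and gradient at [xs] are zero. *)
  have := sos_convex_remainder (xs ord0) ch.
  rewrite [h.@[_]]hxs mpolyC0 subr0 big1 ?subr0// => i _.
  have := hgrad xs; rewrite -gradE subrr grad_polyfun => /rowP/(_ i).
  by rewrite !mxE => ->; rewrite scale0r.
- split=> [|_ [y Fy <-]]; first by exists xs.
  rewrite -subr_ge0; have := sum_of_squares_ge0 y sp; rewrite pE => /le_trans.
  apply; rewrite gerDl; apply: sumr_le0 => i _; have [Vv l0] := vl i.
  by rewrite mulr_ge0_le0//; exact: Fy.
Qed.
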